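(* For almost every $X=(X_k)_{k\in\mathbb{N}}\in\{0,1\}^{\mathbb{N}}$ with respect to the balanced Bernoulli measure, setting $a_X(n)=\sum_{k=0}^nX_k2^k$, one has $$\mathrm{Var}(\mu_{a_X(n)})\sim\frac n2\qquad\text{as } n\to\infty,$$ i.e. $\mathrm{Var}(\mu_{a_X(n)})/(n/2)\to1$.
   Context: $\mathbb{N}=\{0,1,2,\dots\}$. For $n\in\mathbb{N}$, $s_2(n)$ is the number of digits $1$ in the binary expansion of $n$. For $a\in\mathbb{N}$, $\mu_a$ is the probability measure on $\mathbb{Z}$ given by $$\mu_a(d)=\lim_{N\to+\infty}\frac1N\#\{n<N : s_2(n+a)-s_2(n)=d\},\qquad d\in\mathbb{Z}$$ (it is known that these limits exist and define a probability measure, which has mean $0$). The variance is $\mathrm{Var}(\mu_a)=\sum_{d\in\mathbb{Z}}\mu_a(d)\,d^2$. The balanced Bernoulli measure on $\{0,1\}^{\mathbb{N}}$ is the product measure under which the coordinates $X_k$ are independent and take the values $0$ and $1$ with probability $\frac12$ each. *)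

(* Defs.v *)
From mathcomp Require Import all_boot all_order all_algebra finmap.
From mathcomp Require Import all_classical all_reals all_analysis.

Set Implicit Arguments.
Unset Strict Implicit.
Unset Printing Implicit Defensive.

Import Order.TTheory GRing.Theory Num.Theory.
Import numFieldNormedType.Exports.

Local Open Scope classical_set_scope.
Local Open Scope ring_scope.

(* The binary digit of weight 2 ^ k of n is odd (n %/ 2 ^ k). It vanishes for
   k >= n because n < 2 ^ n, so the sum below runs over all nonzero digits. *)
Definition s2 (n : nat) : nat := (\sum_(k < n) odd (n %/ 2 ^ k))%N.

(* [lim] is total: it is the actual limit because these densities exist. *)
Definition mu (R : realType) (a : nat) (d : int) : R :=
  lim ((fun N : nat =>
    #|[pred n : 'I_N | (s2 (n + a)%N)%:Z - (s2 n)%:Z == d]|%:R / N%:R : R)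
    @ \oo).

(* The terms are nonnegative, as required by [esum]. *)
Definition variance_mu (R : realType) (a : nat) : \bar R :=
  \esum_(d in [set: int]) (mu R a d * d%:~R ^+ 2)%:E.

Definition coordinate_events : set (set (nat -> bool)) :=
  [set A | exists k (B : set bool), A = (fun X : nat -> bool => X k) @^-1` B].

(* {0,1}^N with its product sigma-algebra. *)
Notation binary_sequence := (g_sigma_algebraType coordinate_events).

Definition coordinate (k : nat) (X : binary_sequence) : bool := X k.

Definition independent_coordinates (R : realType)
    (P : probability binary_sequence R) : Prop :=
  forall (J : {fset nat}) (B : nat -> set bool),
    P (\bigcap_(k in [set` J]) (coordinate k @^-1` B k)) =
    (\prod_(k <- J) P (coordinate k @^-1` B k))%E.

(* This determines P, since finite intersections of coordinate events form a
   pi-system generating the sigma-algebra. *)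
Definition balanced_bernoulli (R : realType)
    (P : probability binary_sequence R) : Prop :=
  independent_coordinates P /\
  forall (k : nat) (b : bool), P (coordinate k @^-1` [set b]) = (2^-1)%:E.

Definition aX (X : binary_sequence) (n : nat) : nat :=
  (\sum_(k < n.+1) coordinate k X * 2 ^ k)%N.

(* Main.v *)
(* Adding with carries, [mu_(2a) = mu_a], while [mu_(2a+1)] is the half-half
   mixture of [mu_a] shifted by [+1] and [mu_(a+1)] shifted by [-1]; hence
   [Var mu_(2a) = Var mu_a] and
   [Var mu_(2a+1) = (Var mu_a + Var mu_(a+1)) / 2 + 1].  Reading the digits
   [X_0, X_1, ...] of [a] from the least significant one, [Var mu_a] becomes a
   convex combination of [Var mu_q] and [Var mu_(q+1)], [q] being the number
   formed by the digits not yet read, plus an accumulated constant.  If [p_k] is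
   the weight of [Var mu_(q+1)], then [p_(k+1) = (p_k + X_k) / 2] and the
   constant grows by [1/2 - (2 X_k - 1) (2 p_k - 1) / 2].  So [n / 2 - Var] is,
   up to a bounded error, half a martingale with increments bounded by 1.  Its
   second moment at time [n] is at most [n]; Markov's inequality and
   Borel-Cantelli along [n = k ^ 4] give [o(n)] almost surely along this
   subsequence, and bounded increments fill the gaps. *)

Require Import Defs.
From mathcomp Require Import all_boot all_order all_algebra finmap.
From mathcomp Require Import all_classical all_reals all_analysis.
From mathcomp Require Import ring lra zify.

Import Order.TTheory GRing.Theory Num.Theory.
Import numFieldNormedType.Exports.

Local Open Scope classical_set_scope.
Local Open Scope ring_scope.

(** * Binary digit sums and their change under addition, by parity *)

Lemma s2_widen (n K : nat) : (n <= K)%N ->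
  s2 n = (\sum_(k < K) odd (n %/ 2 ^ k))%N.
Proof.
move=> nK; rewrite -(subnKC nK) big_split_ord /= [X in (_ + X)%N]big1 ?addn0 //.
move=> i _; rewrite divn_small //.
by rewrite (leq_trans (ltn_expl n (ltnSn 1))) // leq_exp2l // leq_addr.
Qed.

Lemma s2_bit (b : bool) (n : nat) : s2 (b + n.*2) = (b + s2 n)%N.
Proof.
rewrite (@s2_widen _ (n.*2).+2); last by case: b; lia.
rewrite big_ord_recl expn0 divn1 oddD odd_double addbF oddb; congr addn.
rewrite (@s2_widen n (n.*2).+1); last lia.
by apply: eq_bigr => i _; rewrite /= expnS divnMA divn2 half_bit_double.
Qed.

Lemma s2_double (n : nat) : s2 n.*2 = s2 n.
Proof. exact: (s2_bit false). Qed.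

Lemma s2_doubleS (n : nat) : s2 n.*2.+1 = (s2 n).+1.
Proof. exact: (s2_bit true). Qed.

Definition digit_change (a n : nat) : int := (s2 (n + a))%:Z - (s2 n)%:Z.

Lemma digit_change0 (n : nat) : digit_change 0 n = 0.
Proof. by rewrite /digit_change addn0 subrr. Qed.

Lemma digit_change_even_even (a m : nat) :
  digit_change a.*2 m.*2 = digit_change a m.
Proof. by rewrite /digit_change -doubleD !s2_double. Qed.

Lemma digit_change_even_odd (a m : nat) :
  digit_change a.*2 m.*2.+1 = digit_change a m.
Proof. by rewrite /digit_change addSn -doubleD !s2_doubleS; lia. Qed.

Lemma digit_change_odd_even (a m : nat) :
  digit_change a.*2.+1 m.*2 = digit_change a m + 1.
Proof. by rewrite /digit_change addnS -doubleD s2_doubleS s2_double; lia. Qed.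

(** The two last digits produce a carry: $(2m+1)+(2a+1)=2(m+a+1)$. One digit 1 of $2m+1$ is lost and
    the carry turns $a$ into $a+1$. *)
Lemma digit_change_odd_odd (a m : nat) :
  digit_change a.*2.+1 m.*2.+1 = digit_change a.+1 m - 1.
Proof.
rewrite /digit_change addSnnS -doubleS -doubleD s2_doubleS s2_double; lia.
Qed.

Lemma digit_change1_le (n : nat) : digit_change 1 n <= 1.
Proof.
elim/ltn_ind: n => n IH; rewrite -(odd_double_half n); case: (boolP (odd n)) => on.
  rewrite add1n (digit_change_odd_odd 0).
  have /IH : (n./2 < n)%N by move: on; case: n {IH} => //= n; lia.
  lia.
by rewrite add0n (digit_change_odd_even 0) digit_change0.
Qed.

(** * Natural densities and their splitting by parity *)

Definition has_density {R : realType} (A : pred nat) (l : R) : Prop :=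
  (fun N : nat => (\sum_(n < N) A n)%:R / N%:R : R) @ \oo --> l.

Lemma count_parity (A : pred nat) (N : nat) :
  (\sum_(n < N) A n =
   \sum_(n < uphalf N) A n.*2 + \sum_(n < N./2) A n.*2.+1)%N.
Proof.
elim: N => [|N IH]; first by rewrite !big_ord0.
have AN : A N = A (odd N + N./2.*2)%N by rewrite odd_double_half.
rewrite big_ord_recr IH /= AN uphalf_half.
case: (odd N); rewrite ?add1n ?add0n !big_ord_recr /=; lia.
Qed.

Lemma cvg_invn (R : realType) : (fun N : nat => N%:R^-1 : R) @ \oo --> (0 : R).
Proof. by rewrite -cvg_shiftS; exact: cvg_harmonic. Qed.

(** The hypothesis says $|2h(N)-N|\le 1$, which covers both [uphalf] and [half], the numbers of even
    and odd integers below $N$. *)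
Lemma cvg_half_ratio (R : realType) (h : nat -> nat) :
  (forall N, (h N).*2 <= N.+1 /\ N <= (h N).*2.+1)%N ->
  (fun N : nat => (h N)%:R / N%:R : R) @ \oo --> (2^-1 : R).
Proof.
move=> hE; apply: (@squeeze_cvgr _ _ _ _ (fun N : nat => 2^-1 - N%:R^-1 : R)
  (fun N : nat => 2^-1 + N%:R^-1 : R)).
- near=> N.
  have N0 : (0 < N%:R :> R) by rewrite ltr0n; near: N; exact: nbhs_infty_gt.
  have hb : (2 * (h N)%:R <= N%:R + 1 :> R) /\ (N%:R <= 2 * (h N)%:R + 1 :> R).
    by rewrite -natrM mul2n !natr1 !ler_nat; exact: hE.
  have [h1 h2] := hb.
  rewrite -(ler_pM2r N0) -[X in _ && X](ler_pM2r N0) mulrBl mulrDl.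
  by rewrite divfK ?mulVf ?gt_eqF //; apply/andP; split; lra.
- rewrite -[X in _ --> X]subr0; apply: cvgB; first exact: cvg_cst.
  exact: cvg_invn.
- rewrite -[X in _ --> X]addr0; apply: cvgD; first exact: cvg_cst.
  exact: cvg_invn.
Unshelve. all: by end_near. Qed.

Lemma cvg_ratio_half (R : realType) (u h : nat -> nat) (l : R) :
  (forall N, (h N).*2 <= N.+1 /\ N <= (h N).*2.+1)%N ->
  (fun N : nat => (u N)%:R / N%:R : R) @ \oo --> l ->
  (fun N : nat => (u (h N))%:R / N%:R : R) @ \oo --> l / 2.
Proof.
move=> hE ul.
have hoo : h @ \oo --> \oo.
  apply/cvgnyPge => A; near=> N.
  have : (A.*2.+1 <= N)%N by near: N; exact: nbhs_infty_ge.
  by have := hE N; lia.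
have uhl : (fun N => (u (h N))%:R / (h N)%:R : R) @ \oo --> l.
  exact: (cvg_comp _ _ hoo ul).
apply: cvg_trans (cvgM uhl (@cvg_half_ratio R h hE)).
apply: near_eq_cvg; near=> N => /=.
have hN0 : (h N)%:R != 0 :> R.
  have : (2 <= N)%N by near: N; exact: nbhs_infty_ge.
  by rewrite pnatr_eq0; have := hE N; lia.
by rewrite mulrA divfK.
Unshelve. all: by end_near. Qed.

(** The even and the odd integers each carry half of the density. Existence of the limit for [A] is
    obtained along with its value, which drives all recursions below. *)
Lemma has_density_parity {R : realType} (A B C : pred nat) (lb lc : R) :
  (forall m, A m.*2 = B m) -> (forall m, A m.*2.+1 = C m) ->
  has_density B lb -> has_density C lc -> has_density A ((lb + lc) / 2).
Proof.
move=> AB AC hB hC; rewrite /has_density mulrDl.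
rewrite (_ : (fun N : nat => _) = (fun N : nat =>
    (\sum_(n < uphalf N) B n)%:R / N%:R + (\sum_(n < N./2) C n)%:R / N%:R : R)).
  apply: cvgD.
    apply: (@cvg_ratio_half R (fun N => \sum_(n < N) B n)%N uphalf lb _ hB).
    by move=> N; rewrite uphalf_half; have := odd_double_half N; case: odd; lia.
  apply: (@cvg_ratio_half R (fun N => \sum_(n < N) C n)%N half lc _ hC).
  by move=> N; have := odd_double_half N; case: odd; lia.
apply/funext => N; rewrite count_parity natrD mulrDl.
by congr (_%:R / _ + _%:R / _); apply: eq_bigr => i _; rewrite ?AB ?AC.
Qed.

Lemma has_density_all {R : realType} (A : pred nat) :
  (forall n, A n) -> has_density A (1 : R).
Proof.
move=> Aall; apply: cvg_near_cst; near=> N.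
rewrite (eq_bigr (fun=> 1%N)); last by move=> i _; rewrite Aall.
rewrite sum1_card card_ord divff // pnatr_eq0 -lt0n.
by near: N; exact: nbhs_infty_gt.
Unshelve. all: by end_near. Qed.

Lemma has_density_none {R : realType} (A : pred nat) :
  (forall n, ~~ A n) -> has_density A (0 : R).
Proof.
move=> Anone; rewrite /has_density; apply: cvg_near_cst; near=> N.
by rewrite big1 ?mul0r // => i _; rewrite (negbTE (Anone i)).
Unshelve. all: by end_near. Qed.

Lemma has_density_ge0 {R : realType} (A : pred nat) (l : R) :
  has_density A l -> 0 <= l.
Proof.
move=> hA; rewrite -(cvg_lim _ hA) //; apply: limr_ge; first exact: cvgP hA.
by apply: nearW => N; rewrite divr_ge0.
Qed.

Lemma has_density_eq {R : realType} (A B : pred nat) (l : R) :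
  A =1 B -> has_density B l -> has_density A l.
Proof. by move=> /funext ->. Qed.

(** * The measures [mu] and their recursion *)

Lemma mu_density {R : realType} (a : nat) (d : int) (l : R) :
  has_density (fun n => digit_change a n == d) l -> mu R a d = l.
Proof.
move=> hl; rewrite /mu; apply: cvg_lim => //.
rewrite [X in X @ _](_ : _ = (fun N : nat =>
  (\sum_(n < N) (digit_change a n == d))%:R / N%:R : R)) //.
by apply/funext => N; rewrite -sum1_card big_mkcond.
Qed.

(** Since [lim] is total, a value of [mu] means something only once the limit exists; existence is
    therefore carried through every recursion. *)
Definition has_mu (R : realType) (a : nat) : Prop := forall d,
  has_density (fun n => digit_change a n == d) (mu R a d).

Lemma has_muP (R : realType) (a : nat) (m : int -> R) :
  (forall d, has_density (fun n => digit_change a n == d) (m d)) ->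
  has_mu R a /\ mu R a = m.
Proof.
move=> h; have E : mu R a = m by apply/funext => d; exact: mu_density.
by rewrite /has_mu E.
Qed.

Lemma mu_ge0 (R : realType) (a : nat) (d : int) : has_mu R a -> 0 <= mu R a d.
Proof. by move=> h; exact: has_density_ge0 (h d). Qed.

Lemma mu0 (R : realType) :
  has_mu R 0 /\ mu R 0 = (fun d => if d == 0 then 1 else 0).
Proof.
apply: has_muP => d; case: ifPn => [/eqP -> | d0].
  by apply: has_density_all => n; rewrite digit_change0.
by apply: has_density_none => n; rewrite digit_change0 eq_sym.
Qed.

Lemma mu_double (R : realType) (a : nat) :
  has_mu R a -> has_mu R a.*2 /\ mu R a.*2 = mu R a.
Proof.
move=> h; apply: has_muP => d; rewrite [X in has_density _ X](splitr _) -mulrDl.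
apply: has_density_parity (h d) (h d) => m.
  by rewrite digit_change_even_even.
by rewrite digit_change_even_odd.
Qed.

Lemma mu_doubleS (R : realType) (a : nat) : has_mu R a -> has_mu R a.+1 ->
  has_mu R a.*2.+1 /\
  mu R a.*2.+1 = (fun d => (mu R a (d - 1) + mu R a.+1 (d + 1)) / 2).
Proof.
move=> h h1; apply: has_muP => d.
apply: has_density_parity (h (d - 1)) (h1 (d + 1)) => m.
  by rewrite digit_change_odd_even; lia.
by rewrite digit_change_odd_odd; lia.
Qed.

(** As $1=2\cdot 0+1$, the recursion for [mu R 1] refers to itself, so existence cannot come from
    [mu_doubleS]. Induction on $j$ replaces it: even integers only give the value 1, odd ones lower
    the change at $m$ by 1. *)
Lemma mu1_density (R : realType) (j : nat) :
  has_density (fun n => digit_change 1 n == 1 - j%:Z) ((2 ^+ j.+1)^-1 : R).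
Proof.
elim: j => [|j IH].
  rewrite expr1 -[2^-1]mul1r -[X in X / 2]addr0.
  apply: (@has_density_parity _ _ predT pred0).
  - by move=> m; rewrite (digit_change_odd_even 0) digit_change0.
  - by move=> m; have := digit_change1_le m; rewrite (digit_change_odd_odd 0) /=; lia.
  - exact: has_density_all.
  - exact: has_density_none.
rewrite exprSr invfM -[X in X / 2]add0r.
apply: (@has_density_parity _ _ pred0 _ _ _ _ _ (has_density_none pred0 (fun=> isT)) IH) => m.
  by rewrite (digit_change_odd_even 0) digit_change0 /=; lia.
by rewrite (digit_change_odd_odd 0) /=; lia.
Qed.

(** * Second moments of [mu] *)

(* Second moments about all centers at once: this nonnegative sum also carries
   the total mass and the mean, so no signed sum is ever needed. *)
Definition moment {R : realType} (a : nat) (t : R) : \bar R :=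
  \esum_(d in [set: int]) (mu R a d * (d%:~R + t) ^+ 2)%:E.

Lemma moment0 (R : realType) (t : R) : moment 0 t = (t ^+ 2)%:E.
Proof.
rewrite /moment (proj2 (mu0 R)).
rewrite (@eq_esum _ _ _ _
  (fun d : int => if d \in [set (0 : int)] then (t ^+ 2)%:E else 0%E)).
  by rewrite -esum_mkcond esum_set1 // lee_fin sqr_ge0.
move=> d _; case: (eqVneq d 0) => [->|d0].
  by rewrite mem_set // mul1r mulr0z add0r.
by rewrite memNset ?mul0r //; exact/eqP.
Qed.

Lemma moment_shift (R : realType) (a : nat) (c : int) (t : R) :
  \esum_(d in [set: int]) (mu R a (d - c) * (d%:~R + t) ^+ 2)%:E =
  moment a (t + c%:~R).
Proof.
rewrite (@reindex_esum _ _ _ [set: int] [set: int] (fun d => d + c)).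
  apply: eq_esum => d _; rewrite addrK intrD; congr (_ * _ ^+ 2)%:E; ring.
split=> //=; first by move=> x y _ _ /addIr.
by move=> y _; exists (y - c) => //; rewrite subrK.
Qed.

(** The mixture formula, with each shift of [mu] moved into the center. Doubling both sides avoids a
    division in the extended reals. *)
Lemma moment_doubleS (R : realType) (a : nat) (t : R) :
  has_mu R a -> has_mu R a.+1 ->
  (moment a.*2.+1 t + moment a.*2.+1 t = moment a (t + 1) + moment a.+1 (t - 1))%E.
Proof.
move=> ha ha1; have [h2 E] := mu_doubleS _ _ ha ha1.
rewrite -(moment_shift _ _ 1) -(moment_shift _ _ (-1)) -!esumD;
  do ?by move=> d _; rewrite lee_fin mulr_ge0 ?sqr_ge0 ?mu_ge0.
by apply: eq_esum => d _; rewrite -!EFinD E opprK; congr (_%:E); field.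
Qed.

Lemma mu1 (R : realType) : has_mu R 1 /\
  mu R 1 = (fun d => if d <= 1 then (2 ^+ `|1 - d|%N.+1)^-1 else 0).
Proof.
apply: has_muP => d; case: ifPn => d1.
  apply: has_density_eq (mu1_density R `|1 - d|%N) => n.
  by congr (_ == _); lia.
apply: has_density_none => n; have := digit_change1_le n; lia.
Qed.

(** The distribution is self-similar: the tail from index $n$ on is $2^{-n}$ times the whole series
    with $t$ replaced by $t-n$. *)
Lemma moment1_partial (R : realType) (t : R) (n : nat) :
  \sum_(0 <= j < n) (2 ^+ j.+1)^-1 * ((1 - j%:Z)%:~R + t) ^+ 2 =
  t ^+ 2 + 2 - (2 ^+ n)^-1 * ((t - n%:R) ^+ 2 + 2).
Proof.
elim: n => [|n IH]; first by rewrite big_nil expr0; field.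
rewrite big_nat_recr //= IH.
have -> : (1 - n%:Z)%:~R = 1 - n%:R :> R by rewrite intrB -!pmulrn.
rewrite [2 ^+ n.+1]exprS -[n.+1%:R]natr1.
by field; rewrite expf_eq0 pnatr_eq0 andbF.
Qed.

Lemma cube_le_exp2 (n : nat) : (n ^ 3 <= 4 * 2 ^ n)%N.
Proof.
(* From $n=4$ on, $(n+1)^3\le 2n^3$; smaller cases are computed. *)
elim: n => // n IH; case: (ltnP n 4) => [|n4]; first by case: n {IH} => [|[|[|[|]]]].
rewrite [X in (_ <= 4 * X)%N]expnS mulnCA; apply: leq_trans (leq_mul (leqnn 2) IH).
rewrite !expnS expn0; nia.
Qed.

Lemma cvg_moment1_tail (R : realType) (t : R) :
  (fun n : nat => (2 ^+ n)^-1 * ((t - n%:R) ^+ 2 + 2)) @ \oo --> (0 : R).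
Proof.
(* For $n\ge 1$, $(t-n)^2+2\le(2t^2+4)n^2$; the factor 4 comes from $n^3\le 4\cdot 2^n$. *)
pose C := 4 * (2 * t ^+ 2 + 4).
apply: (@squeeze_cvgr _ _ _ _ (fun=> 0)  (fun n : nat => C * n%:R^-1)).
- near=> n.
  have n1 : (1 <= n%:R :> R) by rewrite ler1n; near: n; exact: nbhs_infty_gt.
  have p0 : (0 < 2 ^+ n :> R) by rewrite exprn_gt0.
  have c4 : (n%:R ^+ 3 <= 4 * 2 ^+ n :> R).
    by rewrite -!natrX -natrM ler_nat cube_le_exp2.
  apply/andP; split.
    by rewrite mulr_ge0 ?invr_ge0 ?exprn_ge0 // addr_ge0 ?sqr_ge0.
  have n0 : (0 < n%:R :> R) by lra.
  rewrite mulrC ler_pdivrMr // mulrAC ler_pdivlMr //.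
  rewrite -[X in X <= _]mulrC.
  have h1 : (t - n%:R) ^+ 2 + 2 <= (2 * t ^+ 2 + 4) * n%:R ^+ 2.
    have : 0 <= (t + n%:R) ^+ 2 by exact: sqr_ge0.
    have : 0 <= t ^+ 2 by exact: sqr_ge0.
    have : 1 <= n%:R ^+ 2 :> R by rewrite exprn_ege1.
    nra.
  rewrite (le_trans (ler_wpM2l (ltW n0) h1)) // /C.
  have : 0 <= (2 * t ^+ 2 + 4) by rewrite addr_ge0 // mulr_ge0 // sqr_ge0.
  move: (2 * t ^+ 2 + 4) => k k0; have := ler_wpM2l k0 c4.
  by rewrite exprS; lra.
- exact: cvg_cst.
- by rewrite -[X in _ --> X](mulr0 C); apply: cvgM; [exact: cvg_cst|exact: cvg_invn].
Unshelve. all: by end_near. Qed.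

(** Summed as a series: in the recursion at $1=2\cdot 0+1$ the moments of [mu R 1] stand on both
    sides, which would not exclude infinite values. *)
Lemma moment1 (R : realType) (t : R) : moment 1 t = (2 + t ^+ 2)%:E.
Proof.
rewrite /moment (proj2 (mu1 R)).
pose e (j : nat) : int := 1 - j%:Z.
rewrite (@eq_esum _ _ _ _ (fun d : int => if d \in e @` [set: nat] then
    ((2 ^+ `|1 - d|%N.+1)^-1 * (d%:~R + t) ^+ 2)%:E else 0%E)); last first.
  move=> d _; case: ifPn => d1.
    by rewrite mem_set //; exists `|1 - d|%N => //; rewrite /e; lia.
  rewrite memNset ?mul0r // => -[j _] jd; move: d1; rewrite -jd /e; lia.
rewrite -esum_mkcond esum_image; last by move=> i j _ _; rewrite /e; lia.
rewrite -nneseries_esumT; last first.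
  by move=> j; rewrite lee_fin mulr_ge0 ?sqr_ge0 // invr_ge0 exprn_ge0.
apply: cvg_lim => //.
rewrite (_ : (fun n => _) = EFin \o (fun n : nat =>
    t ^+ 2 + 2 - (2 ^+ n)^-1 * ((t - n%:R) ^+ 2 + 2))).
  apply: cvg_EFin; first by near=> n.
  rewrite addrC -[X in _ --> X]subr0.
  by apply: cvgB; [exact: cvg_cst|exact: cvg_moment1_tail].
apply/funext => n /=; rewrite -moment1_partial sumEFin; congr (_%:E).
by apply: eq_bigr => j _; rewrite /e; congr ((2 ^+ _.+1)^-1 * _); lia.
Unshelve. all: by end_near. Qed.

(** As a polynomial identity in [t], the second clause encodes total mass 1, mean 0 and variance
    [v]. In the recursion the terms linear in [t] then cancel. *)
Definition has_moments {R : realType} (a : nat) (v : R) : Prop :=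
  has_mu R a /\ forall t, moment a t = (v + t ^+ 2)%:E.

Lemma has_moments0 (R : realType) : has_moments 0 (0 : R).
Proof. by split=> [|t]; [exact: (mu0 R).1|rewrite add0r moment0]. Qed.

Lemma has_moments1 (R : realType) : has_moments 1 (2 : R).
Proof. by split=> [|t]; [exact: (mu1 R).1|rewrite moment1]. Qed.

Lemma has_moments_double (R : realType) (a : nat) (v : R) :
  has_moments a v -> has_moments a.*2 v.
Proof.
by move=> [h m]; have [h2 E] := mu_double _ _ h; split=> // t; rewrite /moment E -m.
Qed.

Lemma has_moments_doubleS (R : realType) (a : nat) (v w : R) :
  has_moments a v -> has_moments a.+1 w ->
  has_moments a.*2.+1 ((v + w) / 2 + 1).
Proof.
move=> [h m] [h1 m1]; split; first exact: (mu_doubleS _ _ h h1).1.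
move=> t; have := moment_doubleS _ _ t h h1; rewrite m m1.
case: (moment _ _) => [r| |] //= /eqP; rewrite -!EFinD eqe => /eqP E.
by congr (_%:E); lra.
Qed.

Lemma has_moments_variance (R : realType) (a : nat) (v : R) :
  has_moments a v -> variance_mu R a = v%:E.
Proof.
move=> [_ m]; have := m 0; rewrite expr0n addr0 => <-.
by apply: eq_esum => d _; rewrite addr0.
Qed.

(** * The variance as a function of the digits *)

Fixpoint bits_value (s : seq bool) : nat :=
  if s is b :: s' then (b + (bits_value s').*2)%N else 0%N.

(* The variance of [mu_a] for [a = bits_value s + c], the digits of [s] being
   listed from the least significant one. *)
Fixpoint bits_variance {R : realType} (c : bool) (s : seq bool) : R :=
  if s is b :: s' then
    if b == c then bits_variance c s'
    else (bits_variance false s' + bits_variance true s') / 2 + 1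
  else if c then 2 else 0.

(** Both values of [c] go through the induction together. With $q$ the value of the tail, [b == c]
    gives the even number $2q$ or $2(q+1)$, and otherwise the number is $2q+1$, which needs both $q$
    and $q+1$. *)
Lemma has_moments_bits (R : realType) (s : seq bool) (c : bool) :
  has_moments (bits_value s + c) (bits_variance c s : R).
Proof.
elim: s c => [|b s IH] c /=.
  by case: c; [exact: has_moments1|exact: has_moments0].
have H0 := IH false; have H1 := IH true.
rewrite addn0 in H0; rewrite addn1 in H1.
case: b; case: c => /=.
- by rewrite add1n addn1 -doubleS; exact: has_moments_double.
- by rewrite addn0 add1n; exact: has_moments_doubleS.
- by rewrite add0n addn1; exact: has_moments_doubleS.
- by rewrite addn0 add0n; exact: has_moments_double.
Qed.

Lemma variance_mu_bits (R : realType) (s : seq bool) :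
  variance_mu R (bits_value s) = (bits_variance false s)%:E.
Proof.
by apply: has_moments_variance; have := has_moments_bits R s false; rewrite addn0.
Qed.

(** * The carry bias and its martingale *)

Definition spin {R : realType} (b : bool) : R := if b then 1 else -1.

(** The update $p\mapsto(p+X)/2$ of the carry weight, rewritten for $g=2p-1$. *)
Definition next_bias {R : realType} (g : R) (b : bool) : R := (g + spin b) / 2.

(* [g] is [2 p - 1], where [p] is the probability that a carry reaches the
   current digit; the increment [spin b * g] is centered given the past. *)
Fixpoint bias_walk {R : realType} (g : R) (s : seq bool) : R :=
  if s is b :: s' then spin b * g + bias_walk (next_bias g b) s' else 0.

Lemma next_bias_bound (R : realType) (g : R) (b : bool) :
  `|g| <= 1 -> `|next_bias g b| <= 1.
Proof. by rewrite /next_bias /spin !ler_norml; case: b => /andP[? ?]; lra. Qed.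

(** Reading a digit preserves the quantity inside the absolute value exactly. Only the end of the
    string contributes an error, namely $1+g\le 2$. *)
Lemma bits_variance_walk (R : realType) (g : R) (s : seq bool) : `|g| <= 1 ->
  `|(1 - g) / 2 * bits_variance false s + (1 + g) / 2 * bits_variance true s
    - ((size s)%:R - bias_walk g s) / 2| <= 2.
Proof.
elim: s g => [|b s IH] g g1.
  by move: g1; rewrite /= !ler_norml => /andP[? ?]; lra.
have := IH _ (next_bias_bound R g b g1).
rewrite /= -[(size s).+1%:R]natr1.
move: (bias_walk _ _) (bits_variance false s) (bits_variance true s) => m u v.
by congr (`|_| <= _); rewrite /next_bias /spin; case: b => /=; field.
Qed.

Lemma bias_walk_bound (R : realType) (g : R) (s : seq bool) : `|g| <= 1 ->
  `|bias_walk g s| <= (size s)%:R.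
Proof.
elim: s g => [|b s IH] g g1 /=; first by rewrite normr0.
rewrite -[(size s).+1%:R]natr1 addrC (le_trans (ler_normD _ _)) // lerD //.
  exact/IH/next_bias_bound.
by rewrite normrM /spin; case: b; rewrite ?normrN normr1 mul1r.
Qed.

Lemma bias_walk_cat (R : realType) (g : R) (s1 s2 : seq bool) : `|g| <= 1 ->
  `|bias_walk g (s1 ++ s2) - bias_walk g s1| <= (size s2)%:R.
Proof.
elim: s1 g => [|b s IH] g g1 /=; first by rewrite subr0 bias_walk_bound.
by rewrite opprD addrACA subrr add0r IH // next_bias_bound.
Qed.

(** * Moments of the walk, as finite sums over all digit strings of a given length *)

Fixpoint bitseqs (n : nat) : seq (seq bool) :=
  if n is m.+1 then map (cons true) (bitseqs m) ++ map (cons false) (bitseqs m)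
  else [:: [::]].

Lemma size_bitseqs (n : nat) : size (bitseqs n) = (2 ^ n)%N.
Proof. by elim: n => //= n IH; rewrite size_cat !size_map IH expnS mul2n addnn. Qed.

Lemma mem_bitseqs (s : seq bool) : s \in bitseqs (size s).
Proof.
by elim: s => //= b s IH; rewrite mem_cat; case: b; rewrite map_f ?orbT.
Qed.

Lemma sum_bitseqsS (R : realType) (n : nat) (F : seq bool -> R) :
  \sum_(s <- bitseqs n.+1) F s =
  \sum_(s <- bitseqs n) (F (true :: s) + F (false :: s)).
Proof. by rewrite /= big_cat !big_map big_split. Qed.

Lemma bias_walk_mean (R : realType) (n : nat) (g : R) :
  \sum_(s <- bitseqs n) bias_walk g s = 0.
Proof.
elim: n g => [|n IH] g; first by rewrite big_seq1.
rewrite sum_bitseqsS (eq_bigr (fun s => bias_walk (next_bias g true) s +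
  bias_walk (next_bias g false) s)); first by rewrite big_split /= !IH addr0.
by move=> s _; rewrite /= /spin; ring.
Qed.

(** Orthogonality of martingale increments: each digit adds at most 1 to the mean square. *)
Lemma bias_walk_second_moment (R : realType) (n : nat) (g : R) : `|g| <= 1 ->
  \sum_(s <- bitseqs n) bias_walk g s ^+ 2 <= n%:R * 2 ^+ n.
Proof.
elim: n g => [|n IH] g g1; first by rewrite big_seq1 expr0n mul0r.
have E b : \sum_(s <- bitseqs n) bias_walk g (b :: s) ^+ 2 =
    2 ^+ n * g ^+ 2 + \sum_(s <- bitseqs n) bias_walk (next_bias g b) s ^+ 2.
  rewrite [LHS](eq_bigr (fun s => g ^+ 2 +
    2 * (spin b * g) * bias_walk (next_bias g b) s +
    bias_walk (next_bias g b) s ^+ 2)); last first.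
    by move=> s _; rewrite /= /spin; case: b; ring.
  (* Once the first digit is fixed, the cross term is a multiple of the mean of the remaining walk,
     which is zero. *)
  rewrite !big_split /= [X in _ + X + _](_ : _ = 0) ?addr0; last first.
    by rewrite -mulr_sumr bias_walk_mean mulr0.
  by rewrite big_const_seq count_predT size_bitseqs iter_addr_0 -[g ^+ 2 *+ _]mulr_natl natrX.
rewrite sum_bitseqsS big_split !E.
have g2 : g ^+ 2 <= 1 by rewrite -(@ler_sqrt R) ?sqrtr_sqr ?sqrtr1.
have p0 : 0 <= 2 ^+ n :> R by exact: exprn_ge0.
have := ler_wpM2l p0 g2.
have := IH _ (next_bias_bound _ _ true g1); have := IH _ (next_bias_bound _ _ false g1).
rewrite -[n.+1%:R]natr1 [2 ^+ n.+1]exprS /=; lra.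
Qed.

Lemma bias_walk_markov (R : realType) (n : nat) (g T : R) : `|g| <= 1 -> 0 < T ->
  (count (fun s => T <= `|bias_walk g s|) (bitseqs n))%:R / 2 ^+ n <=
  n%:R / T ^+ 2.
Proof.
move=> g1 T0; rewrite ler_pdivrMr ?exprn_gt0 // mulrAC ler_pdivlMr ?exprn_gt0 //.
apply: le_trans (bias_walk_second_moment _ n g g1).
rewrite -sum1_count natr_sum mulr_suml [leRHS](bigID (fun s => T <= `|bias_walk g s|)) /=.
rewrite -[leLHS]addr0 lerD //; last by apply: sumr_ge0 => s _; exact: sqr_ge0.
apply: ler_sum => s Ts; rewrite mul1r -[leRHS]real_normK ?num_real //.
by rewrite ler_pXn2r // nnegrE ltW.
Qed.

(** * Prefixes of a random sequence and their probabilities *)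

Lemma bits_value_mkseq (X : nat -> bool) (n : nat) :
  bits_value (mkseq X n) = (\sum_(k < n) X k * 2 ^ k)%N.
Proof.
elim: n X => [|n IH] X; first by rewrite big_ord0.
rewrite big_ord_recl expn0 muln1 /mkseq /= -[1%N]/(1 + 0)%N iotaDl -map_comp.
rewrite -/(mkseq (X \o addn 1) n) IH -muln2 big_distrl; congr addn.
by apply: eq_bigr => k _; rewrite /= expnSr mulnA.
Qed.

Lemma mkseq_addn (T : Type) (f : nat -> T) (m k : nat) :
  mkseq f (m + k) = mkseq f m ++ map f (iota m k).
Proof. by rewrite /mkseq iotaD map_cat. Qed.

Definition cylinder (s : seq bool) : set binary_sequence :=
  [set X | mkseq X (size s) = s].

Lemma cylinderE (s : seq bool) : cylinder s =
  \bigcap_(k in [set` [fset k in iota 0 (size s)]%fset])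
    (coordinate k @^-1` [set nth false s k]).
Proof.
apply/seteqP; split=> X /=.
  by move=> Xs k; rewrite /= !inE mem_iota /= => kn; rewrite -Xs nth_mkseq.
move=> Xs; apply: (@eq_from_nth _ false); first by rewrite size_mkseq.
move=> k; rewrite size_mkseq => kn; rewrite nth_mkseq //.
by apply: (Xs k); rewrite /= !inE mem_iota.
Qed.

Lemma measurable_coordinate (k : nat) (B : set bool) :
  measurable (coordinate k @^-1` B : set binary_sequence).
Proof. by apply: sub_sigma_algebra; exists k, B. Qed.

Lemma measurable_cylinder (s : seq bool) : measurable (cylinder s).
Proof.
rewrite cylinderE; apply: fin_bigcap_measurable => // k _.
exact: measurable_coordinate.
Qed.

Lemma probability_cylinder (R : realType) (P : probability binary_sequence R)
    (s : seq bool) : balanced_bernoulli P ->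
  P (cylinder s) = ((2 ^+ size s)^-1)%:E.
Proof.
move=> hP; rewrite cylinderE hP.1 (eq_bigr (fun=> (2^-1)%:E)); last by move=> k _; exact: hP.2.
rewrite (perm_big (iota 0 (size s))); last first.
  apply: uniq_perm; rewrite ?iota_uniq ?fset_uniq // => k.
  by rewrite inE.
rewrite prodEFin; congr (_%:E).
by rewrite big_const_seq count_predT size_iota -exprVn -Monoid.iteropE.
Qed.

(** A finite union of cylinders. The test [size s == n] supplies the prefix length when [cylinder s]
    is unfolded. *)
Lemma prefix_eventE (Q : pred (seq bool)) (n : nat) :
  [set X : binary_sequence | Q (mkseq X n)] =
  \big[setU/set0]_(s <- bitseqs n | Q s && (size s == n)) cylinder s.
Proof.
rewrite -bigcup_seq_cond; apply/seteqP; split=> X /=.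
  move=> QX; exists (mkseq X n); last by rewrite /cylinder /= size_mkseq.
  by rewrite /= QX size_mkseq eqxx -{2}(size_mkseq X n) mem_bitseqs.
by move=> [s /= /andP[_ /andP[Qs /eqP sn]]]; rewrite /cylinder /= sn => ->.
Qed.

Lemma measurable_prefix_event (Q : pred (seq bool)) (n : nat) :
  measurable [set X : binary_sequence | Q (mkseq X n)].
Proof.
rewrite prefix_eventE; apply: bigsetU_measurable => s _.
exact: measurable_cylinder.
Qed.

(** Subadditivity over the cylinders; an upper bound is all that Borel-Cantelli asks for. *)
Lemma probability_prefix_le (R : realType) (P : probability binary_sequence R)
    (Q : pred (seq bool)) (n : nat) : balanced_bernoulli P ->
  (P [set X | Q (mkseq X n)] <= ((count Q (bitseqs n))%:R / 2 ^+ n)%:E)%E.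
Proof.
move=> hP; rewrite prefix_eventE -sum1_count natr_sum mulr_suml -sumEFin.
elim: (bitseqs n) => [|s L IH]; first by rewrite !big_nil measure0.
rewrite !big_cons; case: (boolP (Q s)) => //= Qs; case: eqP => [sn|_].
  apply: le_trans (measureU2 _ _ _) _.
  - exact: measurable_cylinder.
  - by apply: bigsetU_measurable => t _; exact: measurable_cylinder.
  by apply: leeD => //; rewrite mul1r -sn -(probability_cylinder _ _ _ hP).
apply: le_trans IH _; rewrite leeDr // lee_fin mul1r invr_ge0.
Qed.

(** * Almost sure control along fourth powers *)

Lemma sum_inv_sqr_le2 (R : realType) (n : nat) :
  \sum_(0 <= k < n) (k.+1%:R ^+ 2)^-1 <= 2 :> R.
Proof.
(* The sharper bound $2-1/(n+1)$ is what makes the induction close. *)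
suff : \sum_(0 <= k < n.+1) (k.+1%:R ^+ 2)^-1 <= 2 - n.+1%:R^-1 :> R.
  rewrite big_nat_recr //= => h; apply: le_trans (le_trans h _).
    by rewrite lerDl invr_ge0 exprn_ge0.
  by rewrite gerBl invr_ge0.
elim: n => [|n IH]; first by rewrite big_nat1 expr1n !invr1; lra.
rewrite big_nat_recr //=.
apply: le_trans (lerD IH (lexx _)) _.
rewrite -[n.+2%:R]natr1; have : 1 <= n.+1%:R :> R by rewrite ler1n.
move: (n.+1%:R) => x x1; rewrite -subr_ge0.
rewrite [leRHS](_ : _ = (x * (x + 1) ^+ 2)^-1); last by field; lra.
by rewrite invr_ge0 mulr_ge0 ?sqr_ge0 //; lra.
Qed.

(** With $x=k+1$, length $x^4$ and threshold $x^3$, Markov's inequality gives $x^4/x^6=x^{-2}$,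
    which is summable, while the threshold is still negligible against $x^4$. *)
Lemma ae_bias_walk_sparse (R : realType) (P : probability binary_sequence R)
    (g : R) : balanced_bernoulli P -> `|g| <= 1 ->
  {ae P, forall X : binary_sequence, exists N : nat, forall k : nat, (N <= k)%N ->
    `|bias_walk g (mkseq X (k.+1 ^ 4))| < k.+1%:R ^+ 3}.
Proof.
move=> hP g1.
pose Q (k : nat) : pred (seq bool) := fun s => k.+1%:R ^+ 3 <= `|bias_walk g s|.
pose F k := [set X : binary_sequence | Q k (mkseq X (k.+1 ^ 4))].
have mF k : measurable (F k) by exact: measurable_prefix_event.
(* The exceptional set: sequences exceeding the threshold for infinitely many $k$. *)
exists (lim_sup_set F); split.
- by apply: bigcap_measurable => // i _; exact: bigcup_measurable.
- apply: lim_sup_set_cvg0 => //.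
  apply: (@le_lt_trans _ _ 2%:E); last exact: ltry.
  apply: lime_le; first by apply: is_cvg_nneseries => k _ _; exact: measure_ge0.
  apply: nearW => n.
  apply: (@le_trans _ _ (\sum_(0 <= k < n) ((k.+1%:R ^+ 2)^-1)%:E)%E); last first.
    by rewrite sumEFin lee_fin sum_inv_sqr_le2.
  apply: lee_sum => k _; apply: le_trans (probability_prefix_le _ _ _ _ hP) _.
  rewrite lee_fin; apply: le_trans (bias_walk_markov _ _ _ _ g1 _) _.
    by rewrite exprn_gt0.
  have : k.+1%:R != 0 :> R by rewrite pnatr_eq0.
  rewrite natrX; move: (k.+1%:R) => x x0.
  by rewrite (_ : x ^+ 4 / (x ^+ 3) ^+ 2 = (x ^+ 2)^-1) //; field.
- move=> X /= nX n _; apply: contrapT => h; apply: nX; exists n => k nk.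
  rewrite ltNge; apply/negP => Qk; apply: h; exists k => //.
Qed.

(** * From fourth powers to all lengths *)

Lemma fourth_power_bracket (K n : nat) : (K.+1 ^ 4 <= n)%N ->
  exists2 k, (K <= k)%N & (k.+1 ^ 4 <= n < k.+2 ^ 4)%N.
Proof.
move=> Kn; have ex : exists p, (n < p.+2 ^ 4)%N.
  by exists n; rewrite (@leq_trans n.+2) // -{1}(expn1 n.+2) leq_exp2l.
case: (ex_minnP ex) => k nk kmin.
have Kk : (K <= k)%N.
  rewrite leqNgt; apply/negP => kK; have : (n < n)%N; last by rewrite ltnn.
  by apply: leq_trans nk (leq_trans _ Kn); rewrite leq_exp2r.
exists k => //; rewrite nk andbT.
case: k nk kmin Kk => [|k] nk kmin Kk; first by move: Kk Kn; rewrite leqn0 => /eqP ->.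
by rewrite leqNgt; apply/negP => /kmin; rewrite ltnn.
Qed.

Lemma bias_walk_prefix_diff (R : realType) (g : R) (X : nat -> bool) (m n : nat) :
  `|g| <= 1 -> (m <= n)%N ->
  `|bias_walk g (mkseq X n) - bias_walk g (mkseq X m)| <= n%:R - m%:R.
Proof.
move=> g1 mn; rewrite -{1}(subnKC mn) mkseq_addn.
apply: le_trans (bias_walk_cat _ _ _ _ g1) _.
by rewrite size_map size_iota natrB.
Qed.

Lemma cvg_bias_walk_average (R : realType) (g : R) (X : nat -> bool) (N : nat) :
  `|g| <= 1 ->
  (forall k, (N <= k)%N -> `|bias_walk g (mkseq X (k.+1 ^ 4))| < k.+1%:R ^+ 3) ->
  (fun n => `|bias_walk g (mkseq X n)| / n%:R) @ \oo --> (0 : R).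
Proof.
move=> g1 sparse; apply/cvgr0Pnorm_le => e e0.
(* With $x=k+1\ge 1$, the gap to the next fourth power is at most $15x^3$ and the sparse bound adds
   $x^3$. The total $16x^3$ is at most $e x^4$ once $16\le e x$. *)
pose K := maxn N (Num.bound (16 / e)).
near=> n.
have /fourth_power_bracket[k Kk /andP[kn nk]] : (K.+1 ^ 4 <= n)%N.
  by near: n; exact: nbhs_infty_ge.
have Nk : (N <= k)%N by rewrite (leq_trans (leq_maxl _ _) Kk).
have k16 : 16 <= e * k.+1%:R.
  rewrite mulrC -ler_pdivrMr //; apply: ltW; apply: lt_le_trans (archi_boundP _) _.
    by rewrite divr_ge0 ?ltW.
  by rewrite ler_nat (leq_trans (leq_maxr N _)) // (leq_trans Kk).
have n0 : 0 < n%:R :> R by rewrite ltr0n (leq_trans _ kn) // expn_gt0.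
rewrite ger0_norm ?divr_ge0 // ler_pdivrMr //.
have d := bias_walk_prefix_diff _ _ X _ _ g1 kn.
have := ler_normD (bias_walk g (mkseq X n) - bias_walk g (mkseq X (k.+1 ^ 4)))
  (bias_walk g (mkseq X (k.+1 ^ 4))).
rewrite subrK => W; apply: le_trans W _; have s := sparse k Nk.
have knR : k.+1%:R ^+ 4 <= n%:R :> R by rewrite -natrX ler_nat.
have nkR : n%:R <= (k.+1%:R + 1) ^+ 4 :> R by rewrite natr1 -natrX ler_nat ltnW.
have x1 : 1 <= k.+1%:R :> R by rewrite ler1n.
rewrite natrX in d; move: (k.+1%:R : R) x1 knR nkR k16 s d => x x1 *.
apply: (@le_trans _ _ (16 * x ^+ 3)).
  have : 0 <= (x - 1) * x ^+ 2 by rewrite mulr_ge0 ?sqr_ge0 //; lra.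
  have : 0 <= (x - 1) * x by rewrite mulr_ge0 //; lra.
  lra.
apply: (@le_trans _ _ (e * x ^+ 4)); last by rewrite ler_pM2l.
by rewrite [x ^+ 4]exprS [e * (x * _)]mulrA ler_wpM2r // exprn_ge0 //; lra.
Unshelve. all: by end_near. Qed.

(** * Asymptotics of the variance along a sequence *)

Lemma aX_bits (X : binary_sequence) (n : nat) :
  aX X n = bits_value (mkseq X n.+1).
Proof. by rewrite bits_value_mkseq. Qed.

(** The starting bias $-1$ means no incoming carry: the convex combination then reduces to
    [bits_variance false], the variance itself. *)
Lemma cvg_variance_aX (R : realType) (X : binary_sequence) :
  (fun n => `|bias_walk (- 1 : R) (mkseq X n)| / n%:R) @ \oo --> (0 : R) ->
  (fun n : nat => variance_mu R (aX X n) * ((n%:R / 2)^-1)%:E)%E @ \oo --> 1%:E.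
Proof.
move=> W0.
rewrite (_ : (fun n => _) = EFin \o (fun n : nat =>
    bits_variance false (mkseq X n.+1) * (n%:R / 2)^-1 : R)); last first.
  by apply/funext => n /=; rewrite aX_bits variance_mu_bits.
apply: cvg_EFin; first by near=> n.
(* The 6 bounds the error on twice the variance: $2\cdot 2$ from [bits_variance_walk], 1 since
   [aX X n] has $n+1$ digits, and 1 for the last step of the walk. *)
pose r n : R := 6 * n%:R^-1 + `|bias_walk (- 1 : R) (mkseq X n)| / n%:R.
have r0 : r @ \oo --> (0 : R).
  rewrite -[X in _ --> X]addr0; apply: cvgD => //.
  by rewrite -[X in _ --> X](mulr0 6); apply: cvgM; [exact: cvg_cst|exact: cvg_invn].
apply: (@squeeze_cvgr _ _ _ _ (fun n => 1 - r n) (fun n => 1 + r n)).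
- near=> n.
  have n0 : 0 < n%:R :> R by rewrite ltr0n; near: n; exact: nbhs_infty_gt.
  have g1 : `|- 1 : R| <= 1 by rewrite normrN normr1.
  have := bias_walk_prefix_diff _ _ X _ _ g1 (leqnSn n).
  rewrite [(fine \o _) n]/(bits_variance false (mkseq X n.+1) * (n%:R / 2)^-1).
  have := bits_variance_walk _ _ (mkseq X n.+1) g1.
  rewrite size_mkseq -[n.+1%:R]natr1 opprK.
  move: (bits_variance false _) (bits_variance true _) (bias_walk _ (mkseq X n.+1)) => v v' w.
  rewrite /r; move: (bias_walk _ _) => w0.
  have := ler_norm w0; have := ler_norm (- w0); rewrite normrN !ler_norml.
  move=> h1 h2 /andP[h3 h4] /andP[h5 h6].
  rewrite -(ler_pM2r n0) -[X in _ && X](ler_pM2r n0).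
  have -> : v * (n%:R / 2)^-1 * n%:R = 2 * v by field; lra.
  have -> : (1 - (6 / n%:R + `|w0| / n%:R)) * n%:R = n%:R - 6 - `|w0| by field; lra.
  have -> : (1 + (6 / n%:R + `|w0| / n%:R)) * n%:R = n%:R + 6 + `|w0| by field; lra.
  by apply/andP; split; lra.
- by rewrite -[X in _ --> X]subr0; apply: cvgB => //; exact: cvg_cst.
- by rewrite -[X in _ --> X]addr0; apply: cvgD => //; exact: cvg_cst.
Unshelve. all: by end_near. Qed.

Theorem proposition3p2 (R : realType) (P : probability binary_sequence R)
    (hP : balanced_bernoulli P) :
  {ae P, forall X : binary_sequence,
    (fun n : nat => variance_mu R (aX X n) * ((n%:R / 2)^-1)%:E)%E @ \oo
      --> 1%:E}.
Proof.
have g1 : `|- 1 : R| <= 1 by rewrite normrN normr1.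
apply: filterS (ae_bias_walk_sparse _ _ _ hP g1) => X [N sparse].
exact/cvg_variance_aX/(cvg_bias_walk_average _ _ _ _ g1 sparse).
Qed.
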